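(* Let $H$ be a finite-dimensional Hopf algebra over a field $\Bbbk$ with antipode $S$. Then the sequence $\{\nu_n(H)\}_{n\ge 1}$ of indicators of $H$ is an invariant of the gauge equivalence class of $H$; that is, if $H'$ is a Hopf algebra over $\Bbbk$ which is gauge equivalent to $H$, then $\nu_n(H')=\nu_n(H)$ for all positive integers $n$. Moreover, if $\lambda\in H^*$ is a right integral and $\Lambda\in H$ is a left integral such that $\lambda(\Lambda)=1$, then $$\nu_n(H)=\lambda\big(S(\Lambda^{[n]})\big)$$ for all positive integers $n$.
   Context: For a finite-dimensional Hopf algebra $H$ over $\Bbbk$ with comultiplication $\Delta$, counit $\varepsilon$ and antipode $S$: let $\Delta^{(1)}=\mathrm{id}$, $\Delta^{(n+1)}=(\mathrm{id}\otimes\Delta^{(n)})\circ\Delta$, and let $m^{(n)}:H^{\otimes n}\to H$ be the $n$-fold multiplication ($m^{(1)}=\mathrm{id}$). The $n$-th Sweedler power is $P_n(h)=h^{[n]}=m^{(n)}\circ\Delta^{(n)}(h)$ for $n\ge1$, and $P_0(h)=h^{[0]}=\varepsilon(h)1$. The $n$-th indicator of $H$ ($n\ge 1$) is $\nu_n(H)=\operatorname{Tr}(S\circ P_{n-1})$, the trace of a linear endomorphism of $H$. A gauge transformation of $H$ is an invertible $F\in H\otimes H$ with $(\varepsilon\otimes\mathrm{id})(F)=(\mathrm{id}\otimes\varepsilon)(F)=1$. It is a 2-cocycle if $(1\otimes F)(\mathrm{id}\otimes\Delta)(F)=(F\otimes1)(\Delta\otimes\mathrm{id})(F)$. For a 2-cocycle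 $F$, the twist $H^F$ is the Hopf algebra with the same algebra structure and counit as $H$ and with comultiplication $\Delta_F(h)=F\Delta(h)F^{-1}$. Hopf algebras $H,H'$ over $\Bbbk$ are gauge equivalent if there is a 2-cocycle $F$ of $H$ such that $H'\cong H^F$ as bialgebras. Integrals: $\Lambda\in H$ is a left integral if $h\Lambda=\varepsilon(h)\Lambda$ for all $h\in H$; $\lambda\in H^*$ is a right integral if $\lambda f=f(1)\lambda$ in the convolution algebra $H^*$ for all $f\in H^*$. *)

(* Defs.v *)
From HB Require Import structures.
From mathcomp Require Import all_boot all_algebra all_field.

Set Implicit Arguments.
Unset Strict Implicit.
Unset Printing Implicit Defensive.

Import GRing.Theory.
Local Open Scope ring_scope.

Reserved Notation "u \ox v" (at level 40, left associativity).

(** * Tensor products of finite-dimensional vector spaces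
   [tensor U V] is the space of coordinate matrices in the bases
   [vbasis {:U}] and [vbasis {:V}]. It should only be handled through
   the universal property: [tens] is bilinear, [tlift_tens] extends a
   bilinear map, and [tensor_ext] says that pure tensors span. *)

Definition tensor (K : fieldType) (U V : vectType K) : Type :=
  'M[K]_(\dim {:U}, \dim {:V}).

HB.instance Definition _ (K : fieldType) (U V : vectType K) :=
  Vector.copy (tensor U V) 'M[K]_(\dim {:U}, \dim {:V}).

Section Tensor.
Variables (K : fieldType).
Implicit Types U V W : vectType K.

Definition tens U V (u : U) (v : V) : tensor U V :=
  \matrix_(i, j) (coord (vbasis {:U}) i u * coord (vbasis {:V}) j v).

Definition tlift U V W (b : U -> V -> W) (t : tensor U V) : W :=
  \sum_i \sum_j
     (t : 'M_(_, _)) i j *: b (vbasis {:U})`_i (vbasis {:V})`_j.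

Fact tlift_is_linear U V W (b : U -> V -> W) : linear (tlift b).
Proof.
move=> a s t; rewrite /tlift scaler_sumr -big_split; apply: eq_bigr => i _ /=.
rewrite scaler_sumr -big_split; apply: eq_bigr => j _ /=.
by rewrite !mxE scalerDl scalerA.
Qed.
HB.instance Definition _ U V W (b : U -> V -> W) :=
  GRing.isLinear.Build K (tensor U V) W _ (tlift b) (tlift_is_linear b).

End Tensor.

Notation "u \ox v" := (tens u v) : ring_scope.

Section TensorTheory.
Variables (K : fieldType).
Implicit Types U V W : vectType K.

Lemma tensDl U V (u1 u2 : U) (v : V) : (u1 + u2) \ox v = u1 \ox v + u2 \ox v.
Proof. by apply/matrixP => i j; rewrite !mxE linearD mulrDl. Qed.
Lemma tensDr U V (u : U) (v1 v2 : V) : u \ox (v1 + v2) = u \ox v1 + u \ox v2.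
Proof. by apply/matrixP => i j; rewrite !mxE linearD mulrDr. Qed.
Lemma tensZl U V a (u : U) (v : V) : (a *: u) \ox v = a *: (u \ox v).
Proof. by apply/matrixP => i j; rewrite !mxE linearZ mulrA. Qed.
Lemma tensZr U V a (u : U) (v : V) : u \ox (a *: v) = a *: (u \ox v).
Proof. by apply/matrixP => i j; rewrite !mxE linearZ mulrCA. Qed.

Lemma tensor_sum U V (t : tensor U V) :
  t = \sum_i \sum_j
     (t : 'M_(_, _)) i j *: ((vbasis {:U})`_i \ox (vbasis {:V})`_j).
Proof.
apply/matrixP => i j; rewrite summxE (bigD1 i) //= summxE (bigD1 j) //=.
have fU := basis_free (vbasisP {:U}); have fV := basis_free (vbasisP {:V}).
rewrite !mxE !coord_free // !eqxx mulr1n !mulr1.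
rewrite !big1 ?addr0 // => [k ki|k kj].
  by rewrite summxE big1 // => l _; rewrite !mxE !coord_free // (negPf ki)
    mul0r mulr0.
by rewrite !mxE !coord_free // (negPf kj) !mulr0.
Qed.

Lemma tensor_ext U V W (f g : {linear tensor U V -> W}) :
  (forall u v, f (u \ox v) = g (u \ox v)) -> f =1 g.
Proof.
move=> fg t; rewrite (tensor_sum t) !linear_sum; apply: eq_bigr => i _.
by rewrite !linear_sum; apply: eq_bigr => j _; rewrite !linearZ fg.
Qed.

Lemma tlift_comb U V W a (b1 b2 b : U -> V -> W) (t : tensor U V) :
  (forall u v, b u v = a *: b1 u v + b2 u v) ->
  tlift b t = a *: tlift b1 t + tlift b2 t.
Proof.
move=> bE; rewrite /tlift scaler_sumr -big_split; apply: eq_bigr => i _ /=.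
rewrite scaler_sumr -big_split; apply: eq_bigr => j _ /=.
by rewrite bE scalerDr !scalerA mulrC.
Qed.

Lemma tlift_tens U V W (b : U -> V -> W) :
  (forall v, linear (b^~ v)) -> (forall u, linear (b u)) ->
  forall u v, tlift b (u \ox v) = b u v.
Proof.
move=> bl br u v.
pose fl w : {linear U -> W} :=
  HB.pack (b^~ w) (GRing.isLinear.Build K U W _ (b^~ w) (bl w)).
pose fr w : {linear V -> W} :=
  HB.pack (b w) (GRing.isLinear.Build K V W _ (b w) (br w)).
have -> : b u v = fl v u by [].
rewrite [in RHS](coord_vbasis (memvf u)) linear_sum; apply: eq_bigr => i _.
rewrite linearZ /= -[b _ v]/(fr _ v) [in RHS](coord_vbasis (memvf v)).
rewrite linear_sum scaler_sumr; apply: eq_bigr => j _.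
by rewrite linearZ mxE scalerA.
Qed.

Definition tmap U U' V V' (f : 'Hom(U, U')) (g : 'Hom(V, V')) :
    'Hom(tensor U V, tensor U' V') :=
  linfun (tlift (fun u v => f u \ox g v)).

Lemma tmap_tens U U' V V' (f : 'Hom(U, U')) (g : 'Hom(V, V')) u v :
  tmap f g (u \ox v) = f u \ox g v.
Proof.
rewrite lfunE /= tlift_tens // => [y a x x'|x a y y'].
  by rewrite linearP tensDl tensZl.
by rewrite linearP tensDr tensZr.
Qed.

Definition tassoc U V W : 'Hom(tensor (tensor U V) W, tensor U (tensor V W)) :=
  linfun (tlift (fun s w => tlift (fun u v => u \ox (v \ox w)) s)).

Lemma tassoc_tens U V W (u : U) (v : V) (w : W) :
  tassoc U V W ((u \ox v) \ox w) = u \ox (v \ox w).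
Proof.
rewrite lfunE /= tlift_tens => [|w' a x y|s a x y].
- rewrite tlift_tens // => [v' a x y|u' a x y].
    by rewrite tensDl tensZl.
  by rewrite tensDl tensZl tensDr tensZr.
- exact: tlift_is_linear.
by apply: tlift_comb => u' v'; rewrite !(tensDr, tensZr).
Qed.

End TensorTheory.

(** * Tensor products of algebras: (a \ox b) * (a' \ox b') = aa' \ox bb' *)

Section TensorAlgebra.
Variables (K : fieldType) (A B : falgType K).
Local Notation AB := (tensor A B).

Definition tensor_mul (s t : AB) : AB :=
  tlift (fun a b => tlift (fun a' b' => (a * a') \ox (b * b')) t) s.

Fact tensor_mul_linl t : linear (tensor_mul^~ t).
Proof. by move=> a s s'; apply: tlift_is_linear. Qed.

Fact tensor_mul_linr s : linear (tensor_mul s).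
Proof.
by move=> a x y; apply: tlift_comb => u v; apply: tlift_is_linear.
Qed.

Fact tensor_mul_tens a b a' b' :
  tensor_mul (a \ox b) (a' \ox b') = (a * a') \ox (b * b').
Proof.
have E x y : tlift (fun c d => (x * c) \ox (y * d)) (a' \ox b')
           = (x * a' : A) \ox (y * b' : B).
  rewrite tlift_tens // => [d k c c'|c k d d'].
    by rewrite mulrDr -scalerAr tensDl tensZl.
  by rewrite mulrDr -scalerAr tensDr tensZr.
rewrite /tensor_mul tlift_tens ?E // => [v k x y|u k x y]; rewrite !E.
  by rewrite mulrDl -scalerAl tensDl tensZl.
by rewrite mulrDl -scalerAl tensDr tensZr.
Qed.

Let lin (f : AB -> AB) (h : linear f) : {linear AB -> AB} :=
  HB.pack f (GRing.isLinear.Build K AB AB _ f h).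

Fact tensor_mulA : associative tensor_mul.
Proof.
move=> x y z.
have lx t t' : linear (fun s => tensor_mul s (tensor_mul t t')).
  by move=> k s s'; rewrite tensor_mul_linl.
have lx' t t' : linear (fun s => tensor_mul (tensor_mul s t) t').
  by move=> k s s'; rewrite tensor_mul_linl tensor_mul_linl.
apply: (tensor_ext (f := lin (lx y z)) (g := lin (lx' y z))) => a b /=.
have ly s t' : linear (fun t => tensor_mul s (tensor_mul t t')).
  by move=> k t1 t2; rewrite tensor_mul_linl tensor_mul_linr.
have ly' s t' : linear (fun t => tensor_mul (tensor_mul s t) t').
  by move=> k t1 t2; rewrite tensor_mul_linr tensor_mul_linl.
apply: (tensor_ext (f := lin (ly _ z)) (g := lin (ly' _ z))) => a' b' /=.
have lz s t : linear (fun t' => tensor_mul s (tensor_mul t t')).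
  by move=> k t1 t2; rewrite tensor_mul_linr tensor_mul_linr.
have lz' s t : linear (fun t' => tensor_mul (tensor_mul s t) t').
  by move=> k t1 t2; rewrite tensor_mul_linr.
apply: (tensor_ext (f := lin (lz _ _)) (g := lin (lz' _ _))) => a'' b'' /=.
by rewrite !tensor_mul_tens !mulrA.
Qed.

Fact tensor_mul1l : left_id (1 \ox 1) tensor_mul.
Proof.
move=> x; apply: (tensor_ext (f := lin (tensor_mul_linr (1 \ox 1))) (g := idfun)).
by move=> a b /=; rewrite tensor_mul_tens !mul1r.
Qed.

Fact tensor_mul1r : right_id (1 \ox 1) tensor_mul.
Proof.
move=> x; apply: (tensor_ext (f := lin (tensor_mul_linl (1 \ox 1))) (g := idfun)).
by move=> a b /=; rewrite tensor_mul_tens !mulr1.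
Qed.

Fact tensor_mulDl : left_distributive tensor_mul +%R.
Proof. by move=> x y z; rewrite -[x]scale1r tensor_mul_linl !scale1r. Qed.

Fact tensor_mulDr : right_distributive tensor_mul +%R.
Proof. by move=> x y z; rewrite -[y]scale1r tensor_mul_linr !scale1r. Qed.

Fact tensor_oner_neq0 : (1 \ox 1 : AB) != 0.
Proof.
apply/eqP => t0.
have nz (V : vectType K) (v : V) :
    v != 0 -> exists i, coord (vbasis {:V}) i v != 0.
  move=> v0; apply/existsP; apply: contraNT v0; rewrite negb_exists.
  move=> /forallP z; rewrite (coord_vbasis (memvf v)) big1 // => i _.
  by have := z i; rewrite negbK => /eqP ->; rewrite scale0r.
have [i zi] := nz _ _ (oner_neq0 A); have [j zj] := nz _ _ (oner_neq0 B).
move/matrixP: t0 => /(_ i j) /eqP; rewrite !mxE mulf_eq0.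
by rewrite (negPf zi) (negPf zj).
Qed.

HB.instance Definition _ := GRing.Zmodule_isNzRing.Build AB
  tensor_mulA tensor_mul1l tensor_mul1r tensor_mulDl tensor_mulDr
  tensor_oner_neq0.

Fact tensor_scaleAl (k : K) (x y : AB) : k *: (x * y) = (k *: x) * y.
Proof. apply/esym; exact: (linearZ_LR (lin (tensor_mul_linl y))). Qed.
HB.instance Definition _ := GRing.Lmodule_isLalgebra.Build K AB tensor_scaleAl.

Fact tensor_scaleAr (k : K) (x y : AB) : k *: (x * y) = x * (k *: y).
Proof. apply/esym; exact: (linearZ_LR (lin (tensor_mul_linr x))). Qed.
HB.instance Definition _ := GRing.Lalgebra_isAlgebra.Build K AB tensor_scaleAr.

HB.instance Definition _ := Algebra_isFalgebra.Build K AB.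

Lemma tensM (a a' : A) (b b' : B) :
  (a \ox b) * (a' \ox b') = (a * a') \ox (b * b').
Proof. exact: tensor_mul_tens. Qed.

End TensorAlgebra.

Section TensorAlgebraMorphisms.
Variable (K : fieldType).
Implicit Types A B C : falgType K.

Lemma lfun_tensor_ext A B (W : vectType K) (f g : 'Hom(tensor A B, W)) :
  (forall a b, f (a \ox b) = g (a \ox b)) -> f = g.
Proof. by move=> fg; apply/lfunP; apply: tensor_ext. Qed.

Lemma tensor_ahomP A B C (f : 'Hom(tensor A B, C)) :
  (forall a b a' b',
     f ((a \ox b) * (a' \ox b')) = f (a \ox b) * f (a' \ox b')) ->
  f (1 \ox 1) = 1 -> ahom_in {:tensor A B} f.
Proof.
move=> fM f1; apply/ahom_inP; split=> // s t _ _.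
have -> : f (s * t) = (f \o amulr t)%VF s by rewrite comp_lfunE lfunE.
have -> : f s * f t = (amulr (f t) \o f)%VF s by rewrite comp_lfunE lfunE.
congr (fun_of_lfun _ s); apply: lfun_tensor_ext => a b.
rewrite !comp_lfunE !lfunE /=.
have -> : f (a \ox b * t) = (f \o amull (a \ox b))%VF t.
  by rewrite comp_lfunE lfunE.
have -> : f (a \ox b) * f t = (amull (f (a \ox b)) \o f)%VF t.
  by rewrite comp_lfunE lfunE.
congr (fun_of_lfun _ t); apply: lfun_tensor_ext => a' b'.
by rewrite !comp_lfunE !lfunE /= fM.
Qed.

Fact tmap_is_ahom A A' B B' (f : 'AHom(A, A')) (g : 'AHom(B, B')) :
  ahom_in {:tensor A B} (tmap f g).
Proof.
apply: tensor_ahomP => [a b a' b'|]; last by rewrite tmap_tens !rmorph1.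
by rewrite tensM !tmap_tens tensM !rmorphM.
Qed.
Canonical tmap_ahom A A' B B' (f : 'AHom(A, A')) (g : 'AHom(B, B')) :=
  AHom (tmap_is_ahom f g).

Definition tensl A B (b : B) (a : A) : tensor A B := a \ox b.
Fact tensl_is_linear A B (b : B) : linear (@tensl A B b).
Proof. by move=> k x y; rewrite /tensl tensDl tensZl. Qed.
HB.instance Definition _ A B (b : B) :=
  GRing.isLinear.Build K A (tensor A B) _ (tensl b) (tensl_is_linear b).

Fact tassoc_is_ahom A B C : ahom_in {:tensor (tensor A B) C} (tassoc A B C).
Proof.
apply: tensor_ahomP => [s c s' c'|]; last exact: tassoc_tens.
rewrite tensM.
have [al alE] : exists al, al = tassoc A B C by exists (tassoc A B C).
rewrite -alE; pose L d : 'Hom(_, tensor (tensor A B) C) :=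
  linfun (tensl (d : C)).
have -> : al ((s * s') \ox (c * c')) = (al \o L (c * c') \o amulr s')%VF s.
  by rewrite !comp_lfunE !lfunE.
have -> : al (s \ox c) * al (s' \ox c')
          = (amulr (al (s' \ox c')) \o (al \o L c))%VF s.
  by rewrite !comp_lfunE !lfunE.
congr (fun_of_lfun _ s); apply: lfun_tensor_ext => a b.
rewrite !comp_lfunE !lfunE /= /tensl.
have -> : al ((a \ox b * s') \ox (c * c'))
          = (al \o L (c * c') \o amull (a \ox b))%VF s'.
  by rewrite !comp_lfunE !lfunE.
have -> : al ((a \ox b) \ox c) * al (s' \ox c')
          = (amull (al ((a \ox b) \ox c)) \o (al \o L c'))%VF s'.
  by rewrite !comp_lfunE !lfunE.
congr (fun_of_lfun _ s'); apply: lfun_tensor_ext => a' b'.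
by rewrite !comp_lfunE !lfunE /= /tensl tensM alE !tassoc_tens !tensM.
Qed.
Canonical tassoc_ahom A B C := AHom (tassoc_is_ahom A B C).

(* The identifications k \ox A = A and A \ox k = A. *)
Definition tunitl A : 'Hom(tensor K^o A, A) :=
  linfun (tlift (fun (k : K^o) (a : A) => (k : K) *: a)).
Definition tunitr A : 'Hom(tensor A K^o, A) :=
  linfun (tlift (fun (a : A) (k : K^o) => (k : K) *: a)).

Lemma tunitl_tens A (k : K^o) (a : A) : tunitl A (k \ox a) = (k : K) *: a.
Proof.
rewrite lfunE /= tlift_tens // => [a' x y z|l x y z].
  by rewrite scalerDl scalerA.
by rewrite scalerDr !scalerA mulrC.
Qed.

Lemma tunitr_tens A (a : A) (k : K^o) : tunitr A (a \ox k) = (k : K) *: a.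
Proof.
rewrite lfunE /= tlift_tens // => [l x y z|a' x y z].
  by rewrite scalerDr !scalerA mulrC.
by rewrite scalerDl scalerA.
Qed.

Fact tunitl_is_ahom A : ahom_in {:tensor K^o A} (tunitl A).
Proof.
apply: tensor_ahomP => [k a k' a'|]; last by rewrite tunitl_tens scale1r.
by rewrite tensM !tunitl_tens -scalerAl -scalerAr scalerA.
Qed.
Canonical tunitl_ahom A := AHom (tunitl_is_ahom A).

Fact tunitr_is_ahom A : ahom_in {:tensor A K^o} (tunitr A).
Proof.
apply: tensor_ahomP => [a k a' k'|]; last by rewrite tunitr_tens scale1r.
by rewrite tensM !tunitr_tens -scalerAl -scalerAr scalerA.
Qed.
Canonical tunitr_ahom A := AHom (tunitr_is_ahom A).

Definition tmul A : 'Hom(tensor A A, A) := linfun (tlift *%R).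

Lemma tmul_tens A (a b : A) : tmul A (a \ox b) = a * b.
Proof.
rewrite lfunE /= tlift_tens // => [c k x y|c k x y].
  by rewrite mulrDl scalerAl.
by rewrite mulrDr scalerAr.
Qed.

Definition aconj A (F : A) : 'End(A) := (amulr (F^-1)%R \o amull F)%VF.

Lemma aconjE A (F x : A) : aconj F x = F * x / F.
Proof. by rewrite comp_lfunE !lfunE. Qed.

Fact aconj_is_ahom A (F : A) : F \is a GRing.unit -> ahom_in {:A} (aconj F).
Proof.
move=> uF; apply/ahom_inP; split=> [x y _ _|]; last by rewrite aconjE mulr1 divrr.
by rewrite !aconjE !mulrA mulrVK.
Qed.

Lemma aconjM A (F G x : A) : F \is a GRing.unit -> G \is a GRing.unit ->
  aconj (F * G) x = aconj F (aconj G x).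
Proof. by move=> uF uG; rewrite !aconjE invrM // !mulrA. Qed.

Lemma aconj_ahom A B (f : 'AHom(A, B)) (F x : A) : F \is a GRing.unit ->
  f (aconj F x) = aconj (f F) (f x).
Proof. by move=> uF; rewrite !aconjE !rmorphM rmorphV. Qed.

Lemma unit_tens A B (a : A) (b : B) :
  a \is a GRing.unit -> b \is a GRing.unit -> a \ox b \is a GRing.unit.
Proof.
move=> ua ub; apply/unitrP; exists (a^-1 \ox b^-1).
by rewrite !tensM !mulVr ?divrr.
Qed.

Lemma invr_tens A B (a : A) (b : B) :
  a \is a GRing.unit -> b \is a GRing.unit ->
  (a \ox b)^-1 = a^-1 \ox b^-1.
Proof.
move=> ua ub; apply: (mulrI (unit_tens ua ub)).
by rewrite divrr ?unit_tens // tensM !divrr.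
Qed.

End TensorAlgebraMorphisms.

(** * Bialgebras and Hopf algebras *)

Record bialgebra (K : fieldType) (A : falgType K) := Bialgebra {
  comul : 'AHom(A, tensor A A);
  counit : 'AHom(A, K^o);
  comulA : forall h,
    tassoc A A A (tmap comul \1 (comul h)) = tmap \1 comul (comul h);
  comul_unitl : forall h, tunitl A (tmap counit \1 (comul h)) = h;
  comul_unitr : forall h, tunitr A (tmap \1 counit (comul h)) = h }.

Record hopf (K : fieldType) (A : falgType K) := Hopf {
  bialgebra_of_hopf :> bialgebra A;
  antipode : 'End(A);
  antipodel : forall h,
    tmul A (tmap antipode \1 (comul bialgebra_of_hopf h))
      = (counit bialgebra_of_hopf h : K) *: 1;
  antipoder : forall h,
    tmul A (tmap \1 antipode (comul bialgebra_of_hopf h))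
      = (counit bialgebra_of_hopf h : K) *: 1 }.

Section Twist.
Variables (K : fieldType) (A : falgType K) (B : bialgebra A).

Definition gauge_transformation (F : tensor A A) : Prop :=
  [/\ F \is a GRing.unit,
      tunitl A (tmap (counit B) \1 F) = 1
    & tunitr A (tmap \1 (counit B) F) = 1].

(* An equation in A \ox (A \ox A). *)
Definition cocycle2 (F : tensor A A) : Prop :=
  (1 \ox F) * tmap \1 (comul B) F
    = tassoc A A A ((F \ox 1) * tmap (comul B) \1 F).

Variable F : tensor A A.
Hypotheses (gF : gauge_transformation F) (cF : cocycle2 F).

Let uF : F \is a GRing.unit. Proof. by case: gF. Qed.

Definition twist_comul : 'AHom(A, tensor A A) :=
  (AHom (aconj_is_ahom uF) \o comul B)%AF.

Fact twist_comulE h : twist_comul h = F * comul B h / F.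
Proof. by rewrite comp_lfunE aconjE. Qed.

Let twistE h : twist_comul h = aconj F (comul B h).
Proof. by rewrite comp_lfunE. Qed.

Let tmap_twistl (x : tensor A A) :
  tmap twist_comul \1 x = aconj (F \ox 1) (tmap (comul B) \1 x).
Proof.
rewrite -comp_lfunE; congr (fun_of_lfun _ x); apply: lfun_tensor_ext => a b.
rewrite comp_lfunE !tmap_tens twistE !aconjE invr_tens ?unitr1 // invr1 !tensM.
by rewrite mul1r mulr1.
Qed.

Let tmap_twistr (x : tensor A A) :
  tmap \1 twist_comul x = aconj (1 \ox F) (tmap \1 (comul B) x).
Proof.
rewrite -comp_lfunE; congr (fun_of_lfun _ x); apply: lfun_tensor_ext => a b.
rewrite comp_lfunE !tmap_tens twistE !aconjE invr_tens ?unitr1 // invr1 !tensM.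
by rewrite !id_lfunE mul1r mulr1.
Qed.

Fact twist_comulA h :
  tassoc A A A (tmap twist_comul \1 (twist_comul h))
    = tmap \1 twist_comul (twist_comul h).
Proof.
pose dl := tmap_ahom (comul B) (id_ahom A).
pose dr := tmap_ahom (id_ahom A) (comul B).
pose al := tassoc_ahom A A A.
rewrite tmap_twistl tmap_twistr twistE -[LHS]/(al (aconj _ (dl _))).
rewrite -[RHS]/(aconj _ (dr _)) !(aconj_ahom dl, aconj_ahom dr) //.
rewrite -!aconjM ?unit_tens ?rmorph_unit ?unitr1 // (aconj_ahom al); last first.
  by rewrite unitrMl ?unit_tens ?rmorph_unit ?unitr1.
by rewrite -[dr F]/(tmap _ _ F) cF -[al (dl (comul B h))]/(tassoc _ _ _ _) comulA.
Qed.

Fact twist_unitl h : tunitl A (tmap (counit B) \1 (twist_comul h)) = h.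
Proof.
pose el := (tunitl_ahom A \o tmap_ahom (counit B) (id_ahom A))%AF.
have elE x : tunitl A (tmap (counit B) \1 x) = el x by rewrite comp_lfunE.
rewrite elE twistE (aconj_ahom el) // -!elE comul_unitl.
by case: gF => _ -> _; rewrite aconjE mul1r divr1.
Qed.

Fact twist_unitr h : tunitr A (tmap \1 (counit B) (twist_comul h)) = h.
Proof.
pose er := (tunitr_ahom A \o tmap_ahom (id_ahom A) (counit B))%AF.
have erE x : tunitr A (tmap \1 (counit B) x) = er x by rewrite comp_lfunE.
rewrite erE twistE (aconj_ahom er) // -!erE comul_unitr.
by case: gF => _ _ ->; rewrite aconjE mul1r divr1.
Qed.

Definition twist : bialgebra A :=
  Bialgebra twist_comulA twist_unitl twist_unitr.

End Twist.

Definition bialgebra_iso (K : fieldType) (A A' : falgType K)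
    (B : bialgebra A) (B' : bialgebra A') : Prop :=
  exists phi : 'AHom(A, A'),
    [/\ bijective phi,
        forall h, comul B' (phi h) = tmap phi phi (comul B h)
      & forall h, counit B' (phi h) = counit B h].

(* H^F only needs to be known as a bialgebra here: its antipode exists and is
   determined by the bialgebra structure. *)
Definition gauge_equivalent (K : fieldType) (A A' : falgType K)
    (H : hopf A) (H' : hopf A') : Prop :=
  exists (F : tensor A A) (gF : gauge_transformation H F) (cF : cocycle2 H F),
    bialgebra_iso H' (twist gF cF).

(** * Sweedler powers and indicators *)

Definition lfun_trace (K : fieldType) (V : vectType K) (f : 'End(V)) : K :=
  \tr (passmx.mxof (vbasis {:V}) (vbasis {:V}) f).

Lemma lfun_trace_basis (K : fieldType) (V : vectType K) (f : 'End(V))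
    (e : (\dim {:V}).-tuple V) :
  basis_of {:V} e -> lfun_trace f = \tr (passmx.mxof e e f).
Proof.
move=> eB; have vB := vbasisP {:V}; rewrite /lfun_trace.
have mxC (u v w : (\dim {:V}).-tuple V) := @passmx.mxof_comp K V V V u v w.
set b := vbasis _; rewrite -[f in LHS]comp_lfun1r (mxC b e b) //.
by rewrite mxtrace_mulC -mxC // comp_lfun1l.
Qed.

Section Indicator.
Variables (K : fieldType) (A : falgType K).

(* [tpow n] is the tensor power of A with n.+1 factors; accordingly [comul_iter n]
   and [mul_iter n] are the iterated operations with n.+1 tensor factors. *)
Fixpoint tpow (n : nat) : vectType K :=
  if n is n'.+1 then tensor A (tpow n') else A.

Fixpoint comul_iter (H : hopf A) (n : nat) : 'Hom(A, tpow n) :=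
  if n is n'.+1 then (tmap \1 (comul_iter H n') \o comul H)%VF else \1%VF.

Fixpoint mul_iter (n : nat) : 'Hom(tpow n, A) :=
  if n is n'.+1 then (tmul A \o tmap \1 (mul_iter n'))%VF else \1%VF.

Definition sweedler (H : hopf A) (n : nat) : 'End(A) :=
  if n is n'.+1 then (mul_iter n' \o comul_iter H n')%VF
  else linfun (fun h => (counit H h : K) *: (1 : A)).

Lemma sweedler0E (H : hopf A) (h : A) : sweedler H 0 h = (counit H h : K) *: 1.
Proof.
have e_lin : linear (fun x : A => (counit H x : K) *: (1 : A)).
  by move=> k x y; rewrite linearP scalerDl scalerA.
pose e : {linear A -> A} := HB.pack (fun x : A => (counit H x : K) *: (1 : A))
  (GRing.isLinear.Build K A A _ _ e_lin).
exact: (lfunE e h).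
Qed.

(* Only n >= 1 is meaningful: n = 0 repeats the value at n = 1. *)
Definition indicator (H : hopf A) (n : nat) : K :=
  lfun_trace (antipode H \o sweedler H n.-1)%VF.

Definition left_integral (H : hopf A) (Lam : A) : Prop :=
  forall h, h * Lam = (counit H h : K) *: Lam.

Definition convol (H : hopf A) (f g : 'Hom(A, K^o)) : 'Hom(A, K^o) :=
  (tmul K^o \o tmap f g \o comul H)%VF.

Definition right_integral (H : hopf A) (lam : 'Hom(A, K^o)) : Prop :=
  forall f : 'Hom(A, K^o), convol H lam f = (f 1 : K) *: lam.

End Indicator.

(* Main.v *)
From HB Require Import structures.
Require Import Defs.
From mathcomp Require Import all_boot all_algebra all_field.

(* The indicators are invariant by cyclicity of the trace.  Let [F = F1 \ox F2],
   [F^-1 = G1 \ox G2], and let [F_n] conjugate the [n]-fold comultiplication of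
   [H] into the one of [H^F].  The antipode of [H^F] is [h |-> U S(h) V] with
   [U = F1 S(F2)] and [V = S(G1) G2].  Since [S] is anti-multiplicative, moving
   [F1] and [G2] around the trace of
     [h |-> F1 S(F2) S(m(F_n h_(1..n) F_n^-1)) S(G1) G2]
   turns it into the trace of
     [h |-> S(G1 m(F_n (F1 h G2)_(1..n) F_n^-1) F2)].
   Here [F_n], [F1] and [F2] assemble to [F_n Delta_n(F1) \ox F2], which is
   [F_{n+1}] by the cocycle condition, while [G1], [G2] and [F_n^-1] assemble to
   [G1 \ox Delta_n(G2) F_n^-1 = F_{n+1}^-1]; interleaved with the [h_i] they only
   enter through the product [F_{n+1}^-1 F_{n+1} = 1].

   For the formula with integrals, [S(h) Lam_1 \ox Lam_2 = Lam_1 \ox h Lam_2] gives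
   [h = lam(S(h) Lam_1) Lam_2], so that [S] is invertible and
   [h = lam(h Lam_1) S(Lam_2)].  Thus [Lam_1] and [S(Lam_2)] are dual bases for the
   form [lam(xy)], whence [Tr f = lam(S(Lam_2) f(Lam_1))]; take [f = S o P_{n-1}]. *)

Set Implicit Arguments.
Unset Strict Implicit.
Unset Printing Implicit Defensive.

Import GRing.Theory.
Local Open Scope ring_scope.

(** * Tensors, algebras and traces *)

Section TensorInduction.
Variable K : fieldType.
Implicit Types U V W : vectType K.

Lemma lfunD U V (f : 'Hom(U, V)) x y : f (x + y) = f x + f y.
Proof. exact: linearD. Qed.

Lemma lfunZ U V (f : 'Hom(U, V)) k x : f (k *: x) = k *: f x.
Proof. exact: linearZ. Qed.

Lemma tliftD U V W (b : U -> V -> W) s t : tlift b (s + t) = tlift b s + tlift b t.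
Proof. exact: linearD. Qed.

Lemma tens0l U V (v : V) : 0 \ox v = 0 :> tensor U V.
Proof. by rewrite -(scale0r 0) tensZl scale0r. Qed.

(** A scalar can be absorbed into the left factor of a pure tensor, so additivity covers all linear
    combinations. *)
Lemma tensor_ind U V (P : tensor U V -> Prop) :
  (forall u v, P (u \ox v)) -> (forall s t, P s -> P t -> P (s + t)) ->
  forall t, P t.
Proof.
move=> Pt PD t; have P0 : P 0 by rewrite -(tens0l _ 0); apply: Pt.
rewrite (tensor_sum t); elim/big_ind: _ => // i _.
by elim/big_ind: _ => // j _; rewrite -tensZl.
Qed.

Lemma tmap_comp U U' U'' V V' V'' (f : 'Hom(U, U')) (f' : 'Hom(U', U''))
    (g : 'Hom(V, V')) (g' : 'Hom(V', V'')) t :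
  tmap f' g' (tmap f g t) = tmap (f' \o f) (g' \o g) t.
Proof.
elim/tensor_ind: t => [u v|s t Hs Ht]; last by rewrite !lfunD Hs Ht.
by rewrite !tmap_tens !comp_lfunE.
Qed.

Lemma tassoc_tmap U U' V V' W W' (f : 'Hom(U, U')) (g : 'Hom(V, V'))
    (k : 'Hom(W, W')) t :
  tassoc U' V' W' (tmap (tmap f g) k t) = tmap f (tmap g k) (tassoc U V W t).
Proof.
elim/tensor_ind: t => [s w|s t Hs Ht]; last by rewrite !lfunD Hs Ht.
elim/tensor_ind: s => [u v|s t Hs Ht]; last by rewrite tensDl !lfunD Hs Ht.
by rewrite tassoc_tens !tmap_tens tassoc_tens.
Qed.

End TensorInduction.

(** * Traces and dual bases *)

Section Trace.
Variable K : fieldType.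
Implicit Types U V : vectType K.

Lemma lfun_traceE V (f : 'End(V)) :
  lfun_trace f = \sum_i coord (vbasis {:V}) i (f (vbasis {:V})`_i).
Proof.
rewrite /lfun_trace /mxtrace; apply: eq_bigr => i _; rewrite mxE /=.
by rewrite passmx.vecof_delta mxE.
Qed.

Lemma lfun_traceC U V (f : 'Hom(U, V)) (g : 'Hom(V, U)) :
  lfun_trace (f \o g)%VF = lfun_trace (g \o f)%VF.
Proof.
have E U' V' (f' : 'Hom(U', V')) (g' : 'Hom(V', U')) :
    lfun_trace (f' \o g')%VF = \sum_(i < \dim {:V'}) \sum_(j < \dim {:U'})
      coord (vbasis {:U'}) j (g' (vbasis {:V'})`_i) *
      coord (vbasis {:V'}) i (f' (vbasis {:U'})`_j).
  rewrite lfun_traceE; apply: eq_bigr => i _; rewrite comp_lfunE.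
  rewrite {1}(coord_vbasis (memvf (g' _))) !linear_sum /=.
  by apply: eq_bigr => j _; rewrite !linearZ.
rewrite !E exchange_big /=; apply: eq_bigr => i _; apply: eq_bigr => j _.
by rewrite mulrC.
Qed.

Lemma lfun_traceD V (f g : 'End(V)) :
  lfun_trace (f + g) = lfun_trace f + lfun_trace g.
Proof.
rewrite !lfun_traceE -big_split; apply: eq_bigr => i _.
by rewrite add_lfunE linearD.
Qed.

(* A one-sided dual basis is two-sided: [B *m C = 1] forces [C *m B = 1]. *)
Lemma lfun_trace_dual V (b : V -> V -> K) (t : tensor V V) (f : 'End(V)) :
  (forall u, linear (b u : V -> K^o)) ->
  (forall v, v = tlift (fun x y => b v x *: y) t) ->
  lfun_trace f = tlift (fun x y => b y (f x) : K^o) t.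
Proof.
move=> br bt; set e := vbasis {:V}.
pose B : 'M[K]_(\dim {:V}) := \matrix_(i, j) b e`_i e`_j; pose C : 'M_(_, _) := t.
have suml u (I : finType) (c : I -> K) (w : I -> V) :
    b u (\sum_i c i *: w i) = \sum_i c i * b u (w i).
  pose fr : {linear V -> K^o} :=
    HB.pack (b u) (GRing.isLinear.Build K V K^o _ (b u) (br u)).
  rewrite -[LHS]/(fr _) linear_sum; apply: eq_bigr => i _.
  by rewrite linearZ.
have fe : free e := basis_free (vbasisP {:V}).
have BC : B *m C = 1%:M.
  apply/matrixP => k j; have := congr1 (coord e j) (bt e`_k).
  rewrite coord_free // => ej; rewrite [RHS]mxE ej mxE /tlift.
  rewrite linear_sum; apply: eq_bigr => i _; rewrite mxE linear_sum.
  rewrite (bigD1 j) //= big1 => [|l lj]; rewrite !linearZ /= coord_free //.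
    by rewrite eqxx mulr1 addr0 mulrC.
  by rewrite (negPf lj) !mulr0.
have CB (i k : 'I__) c :
    \sum_j C i j * (c * b e`_j e`_k) = c * (i == k)%:R.
  have /matrixP /(_ i k) := mulmx1C BC; rewrite !mxE => <-.
  by rewrite mulr_sumr; apply: eq_bigr => j _; rewrite mulrCA !mxE.
rewrite lfun_traceE; apply: eq_bigr => i _.
(* Expanding the image under [f] of the [i]-th basis vector leaves entries of [C *m B], so only
   [k = i] survives. *)
transitivity (\sum_j C i j * \sum_k coord e k (f e`_i) * b e`_j e`_k); last first.
  by apply: eq_bigr => j _; rewrite -suml -coord_vbasis ?memvf.
under eq_bigr do rewrite mulr_sumr.
rewrite exchange_big /= (bigD1 i) //= CB eqxx mulr1 big1 ?addr0 // => k ki.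
by rewrite CB eq_sym (negPf ki) mulr0.
Qed.

End Trace.

Lemma amullE (K : fieldType) (A : falgType K) (a x : A) : amull a x = a * x.
Proof. by rewrite lfunE. Qed.

Lemma amulrE (K : fieldType) (A : falgType K) (a x : A) : amulr a x = x * a.
Proof. by rewrite lfunE. Qed.

Lemma ahomM (K : fieldType) (A B : falgType K) (f : 'AHom(A, B)) x y :
  f (x * y) = f x * f y.
Proof. exact: rmorphM. Qed.

Lemma ahom1 (K : fieldType) (A B : falgType K) (f : 'AHom(A, B)) : f 1 = 1.
Proof. exact: rmorph1. Qed.

Lemma linfun_tensl (K : fieldType) (A B : falgType K) (a : A) (b : B) :
  linfun (tensl b) a = a \ox b.
Proof. by rewrite lfunE. Qed.

Section TensorEmbeddings.
Variables (K : fieldType) (A B : falgType K).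

Fact linfun_tensl_is_ahom : ahom_in {:A} (linfun (tensl (1 : B)) : 'Hom(A, _)).
Proof.
by apply/ahom_inP; split=> [x y _ _|]; rewrite !linfun_tensl // tensM mulr1.
Qed.
Definition tensl_ahom := AHom linfun_tensl_is_ahom.

Lemma tensl_ahomE a : tensl_ahom a = a \ox 1.
Proof. exact: linfun_tensl. Qed.

Definition tensr (a : A) (b : B) : tensor A B := a \ox b.
Fact tensr_is_linear a : linear (tensr a).
Proof. by move=> k x y; rewrite /tensr tensDr tensZr. Qed.
HB.instance Definition _ a :=
  GRing.isLinear.Build K B (tensor A B) _ (tensr a) (tensr_is_linear a).

Lemma linfun_tensr a b : linfun (tensr a) b = a \ox b.
Proof. by rewrite lfunE. Qed.

Lemma lfun_dual_inj (u v : A) : (forall f : 'Hom(A, K^o), f u = f v) -> u = v.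
Proof.
move=> fuv; rewrite (coord_vbasis (memvf u)) (coord_vbasis (memvf v)).
apply: eq_bigr => i _; congr (_ *: _).
have := fuv (linfun (coord (vbasis {:A}) i : A -> K^o)).
by rewrite !lfunE.
Qed.

(** By finite dimension the injective map [g] is bijective. This serves to invert the antipode. *)
Lemma lfun_linvr (f g : 'End(A)) : (f \o g)%VF = \1%VF -> (g \o f)%VF = \1%VF.
Proof.
move=> fg1; have g0 : lker g == 0%VS.
  apply/lker0P => x y gxy.
  by rewrite -[x]id_lfunE -[y]id_lfunE -fg1 !comp_lfunE gxy.
by rewrite -[LHS]comp_lfun1r -(lker0_compfV g0) -comp_lfunA (comp_lfunA f) fg1
  comp_lfun1l.
Qed.

End TensorEmbeddings.

(** * Convolution and antipodes *)

Section Convolution.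
Variables (K : fieldType) (C : falgType K) (B : bialgebra C).
Implicit Types A : falgType K.

(** The target algebra is arbitrary: [left_integral_comul] convolves maps into [tensor A A]. *)
Definition conv A (f g : 'Hom(C, A)) : 'Hom(C, A) :=
  (tmul A \o tmap f g \o comul B)%VF.

Lemma convE A (f g : 'Hom(C, A)) h : conv f g h = tmul A (tmap f g (comul B h)).
Proof. by rewrite !comp_lfunE. Qed.

Lemma convA A (f g k : 'Hom(C, A)) : conv f (conv g k) = conv (conv f g) k.
Proof.
apply/lfunP => h; rewrite !convE.
rewrite -[f in LHS]comp_lfun1r -[k in RHS]comp_lfun1r /conv -!tmap_comp -comulA.
elim/tensor_ind: (tmap (comul B) \1 _) => [s c|s t Hs Ht]; last by rewrite !lfunD Hs Ht.
elim/tensor_ind: s => [a b|s t Hs Ht].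
  by rewrite tassoc_tens !tmap_tens !comp_lfunE !tmap_tens !tmul_tens mulrA.
by rewrite tensDl !lfunD Hs Ht.
Qed.

Definition conv_unit A (h : C) : A := (counit B h : K) *: 1.

Fact conv_unit_is_linear A : linear (@conv_unit A).
Proof. by move=> k x y; rewrite /conv_unit linearP scalerDl scalerA. Qed.
HB.instance Definition _ A := GRing.isLinear.Build K C A _
  (@conv_unit A) (@conv_unit_is_linear A).

Definition convu A : 'Hom(C, A) := linfun (@conv_unit A).

Lemma convuE A h : convu A h = (counit B h : K) *: 1.
Proof. by rewrite lfunE. Qed.

(** [amull a \o convu A] is [h |-> eps(h) a]: [a = 1] gives the unit law, and a general [a] lets
    constants leave a convolution. *)
Lemma conv1l A (f : 'Hom(C, A)) a :
  conv (amull a \o convu A) f = (amull a \o f)%VF.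
Proof.
apply/lfunP => h; rewrite convE comp_lfunE ?amullE ?amulrE -[h in RHS](comul_unitl B).
elim/tensor_ind: (comul B h) => [x y|s t Hs Ht].
  rewrite !tmap_tens tmul_tens tunitl_tens comp_lfunE convuE ?amullE ?amulrE id_lfunE.
  by rewrite linearZ /= -scalerAr mulr1 -scalerAl -scalerAr.
by rewrite !lfunD mulrDr Hs Ht.
Qed.

Lemma conv1r A (f : 'Hom(C, A)) a :
  conv f (amulr a \o convu A) = (amulr a \o f)%VF.
Proof.
apply/lfunP => h; rewrite convE comp_lfunE ?amullE ?amulrE -[h in RHS](comul_unitr B).
elim/tensor_ind: (comul B h) => [x y|s t Hs Ht].
  rewrite !tmap_tens tmul_tens tunitr_tens comp_lfunE convuE ?amullE ?amulrE id_lfunE.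
  by rewrite linearZ /= -scalerAl mul1r -scalerAl -scalerAr.
by rewrite !lfunD mulrDl Hs Ht.
Qed.

Lemma convul A (f : 'Hom(C, A)) : conv (convu A) f = f.
Proof. by have := conv1l f 1; rewrite amull1 !comp_lfun1l. Qed.

Lemma convur A (f : 'Hom(C, A)) : conv f (convu A) = f.
Proof. by have := conv1r f 1; rewrite rmorph1 !comp_lfun1l. Qed.

(** Right multiplication by [a] is right convolution with [h |-> eps(h) a], so this is
    associativity. *)
Lemma conv_amulr A (f g : 'Hom(C, A)) a :
  conv f (amulr a \o g) = (amulr a \o conv f g)%VF.
Proof. by rewrite -conv1r convA conv1r. Qed.

Lemma comp_conv A A' (phi : 'AHom(A, A')) (f g : 'Hom(C, A)) :
  (phi \o conv f g)%VF = conv (phi \o f) (phi \o g).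
Proof.
apply/lfunP => h; rewrite comp_lfunE !convE -tmap_comp.
elim/tensor_ind: (tmap f g _) => [a b|s t Hs Ht]; last by rewrite !lfunD Hs Ht.
by rewrite tmap_tens !tmul_tens rmorphM.
Qed.

End Convolution.

Section Antipode.
Variables (K : fieldType) (A : falgType K) (H : hopf A).
Local Notation S := (antipode H).

Lemma conv_antipodel : conv H S \1 = convu H A.
Proof. by apply/lfunP => h; rewrite convE convuE antipodel. Qed.

Lemma conv_antipoder : conv H \1 S = convu H A.
Proof. by apply/lfunP => h; rewrite convE convuE antipoder. Qed.

Lemma antipode1 : S 1 = 1.
Proof.
have := antipodel H 1; rewrite !ahom1 tmap_tens tmul_tens id_lfunE mulr1.
by move=> ->; rewrite scale1r.
Qed.

(* For fixed [a], [b |-> S(a1 b) a2] convolved with the identity is [eps(a)] times the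
   unit, so [S(a1 b) a2 = eps(a) S(b)]; convolving this with [S] in [a] concludes. *)
Lemma antipodeM a b : S (a * b) = S b * S a.
Proof.
pose g x := (tmul A \o tmap S \1 \o amull x \o linfun (tensl (1 : A)))%VF.
have gE x c : g x c = tmul A (tmap S \1 (x * (c \ox 1))).
  by rewrite !comp_lfunE amullE linfun_tensl.
have gS c : g (comul H c) = (amull ((counit H c : K) *: 1) \o S)%VF.
  (* Convolving with [\1] and then with [S] changes nothing, so it is enough to compute [g]
     convolved with [\1]. *)
  rewrite -(convur H (g _)) -conv_antipoder convA.
  suff -> : conv H (g (comul H c)) \1
          = (amull ((counit H c : K) *: 1) \o convu H A)%VF by rewrite conv1l.
  apply/lfunP => d; rewrite convE comp_lfunE convuE amullE -scalerAl mul1r scalerA.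
  have -> : (counit H c : K) * counit H d = counit H (c * d) by rewrite ahomM.
  rewrite -antipodel ahomM.
  elim/tensor_ind: (comul H d) => [x y|s t Hs Ht]; last first.
    by rewrite mulrDr !lfunD Hs Ht.
  rewrite tmap_tens tmul_tens id_lfunE gE.
  elim/tensor_ind: (comul H c) => [x' y'|s t Hs Ht].
    by rewrite !tensM !tmap_tens !tmul_tens !id_lfunE mulr1 mulrA.
  by rewrite !mulrDl !lfunD mulrDl Hs Ht.
have kS : (S \o amulr b)%VF = (amull (S b) \o S)%VF.
  rewrite -(convur H (_ \o _)%VF) -conv_antipoder convA.
  suff -> : conv H (S \o amulr b)%VF \1 = (amull (S b) \o convu H A)%VF.
    by rewrite conv1l.
  apply/lfunP => c; rewrite convE comp_lfunE convuE amullE.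
  have := congr1 (fun f : 'End(A) => f b) (gS c).
  rewrite /= gE comp_lfunE amullE -scalerAr -scalerAl mul1r mulr1 => <-.
  elim/tensor_ind: (comul H c) => [x y|s t Hs Ht]; last first.
    by rewrite mulrDl !lfunD Hs Ht.
  by rewrite tensM !tmap_tens !tmul_tens !comp_lfunE amulrE !id_lfunE mulr1.
by have := congr1 (fun f : 'End(A) => f a) kS; rewrite /= !comp_lfunE amulrE amullE.
Qed.

End Antipode.

(** * Sweedler powers as convolution powers of the identity *)

Section SweedlerPowers.
Variable K : fieldType.

(** Starting at the convolution unit treats [n = 0] uniformly; taking a bialgebra makes the powers
    available for a twist. *)
Fixpoint conv_pow (A : falgType K) (B : bialgebra A) n : 'End(A) :=
  if n is n'.+1 then conv B \1 (conv_pow B n') else convu B A.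

Lemma sweedlerE (A : falgType K) (H : hopf A) n : sweedler H n = conv_pow H n.
Proof.
case: n => [|n]; first by apply/lfunP => h; rewrite sweedler0E -convuE.
rewrite -[LHS]/(mul_iter A n \o comul_iter H n)%VF.
elim: n => [|n IHn]; first by rewrite /= comp_lfun1l convur.
apply/lfunP => h; rewrite -[conv_pow H n.+2]/(conv H \1 (conv_pow H n.+1)) -IHn.
  by rewrite convE /= !comp_lfunE tmap_comp comp_lfun1l.
Qed.

(** [conv_pow] grows on the left, while [trace_antipode] convolves with the identity on the
    right. *)
Lemma conv_powSr (A : falgType K) (B : bialgebra A) n :
  conv_pow B n.+1 = conv B (conv_pow B n) \1.
Proof.
elim: n => [|n IHn]; first by rewrite /= convul convur.
by rewrite -[LHS]/(conv B \1 (conv_pow B n.+1)) {1}IHn convA.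
Qed.

End SweedlerPowers.

(** * Bialgebra morphisms and uniqueness of the antipode *)

Section BialgebraMorphism.
Variables (K : fieldType) (A A' : falgType K) (B : bialgebra A) (B' : bialgebra A').
Variable phi : 'AHom(A, A').
Hypothesis phi_comul : forall h, comul B' (phi h) = tmap phi phi (comul B h).
Hypothesis phi_counit : forall h, counit B' (phi h) = counit B h.

Lemma conv_comp (D : falgType K) (f g : 'Hom(A', D)) :
  (conv B' f g \o phi)%VF = conv B (f \o phi) (g \o phi).
Proof.
by apply/lfunP => h; rewrite comp_lfunE !convE phi_comul tmap_comp.
Qed.

Lemma convu_comp (D : falgType K) : (convu B' D \o phi)%VF = convu B D.
Proof. by apply/lfunP => h; rewrite comp_lfunE !convuE phi_counit. Qed.

Lemma comp_convu : (phi \o convu B A)%VF = convu B A'.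
Proof. by apply/lfunP => h; rewrite comp_lfunE !convuE linearZ /= rmorph1. Qed.

Lemma conv_pow_comp n : (phi \o conv_pow B n)%VF = (conv_pow B' n \o phi)%VF.
Proof.
elim: n => [|n IHn] /=; first by rewrite comp_convu convu_comp.
by rewrite comp_conv conv_comp IHn comp_lfun1l comp_lfun1r.
Qed.

(** Under convolution [phi \o S] is a left inverse of [phi] and [S' \o phi] a right inverse, so they
    agree. *)
Lemma antipode_comp (S : 'End(A)) (S' : 'End(A')) :
  conv B S \1 = convu B A -> conv B' \1 S' = convu B' A' ->
  (phi \o S)%VF = (S' \o phi)%VF.
Proof.
move=> Sl S'r; rewrite -(convur B (phi \o S)) -convu_comp -S'r conv_comp convA.
by rewrite comp_lfun1l -{2}[ahval phi]comp_lfun1r -comp_conv Sl comp_convu convul.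
Qed.

End BialgebraMorphism.

(** * Integrals *)

Section Integrals.
Variables (K : fieldType) (A : falgType K) (H : hopf A).
Local Notation S := (antipode H).
Variables (lam : 'Hom(A, K^o)) (Lam : A).
Hypotheses (lamP : right_integral H lam) (LamP : left_integral H Lam).
Hypothesis lam1 : lam Lam = 1.

(** Every functional [f] takes the same value on both sides: evaluate [lam f = f(1) lam] at
    [Lam]. *)
Lemma right_integral_comul : tunitl A (tmap lam \1 (comul H Lam)) = 1.
Proof.
apply: lfun_dual_inj => f; have := congr1 (fun g : 'Hom(_, _) => g Lam) (lamP f).
rewrite scale_lfunE lam1 [RHS]mulr1 => <-; rewrite !comp_lfunE.
elim/tensor_ind: (comul H Lam) => [x y|s t Hs Ht]; last by rewrite !lfunD Hs Ht.
by rewrite !tmap_tens tunitl_tens tmul_tens id_lfunE linearZ.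
Qed.

(** With [L a = a \ox 1] and [R b = 1 \ox b], the comultiplication is the convolution of [L] and
    [R], so [R] is that of [L \o S] and [comul H]. Multiplying by [comul H Lam] on the right turns
    [comul H] into the counit. *)
Lemma left_integral_comul h :
  (1 \ox h) * comul H Lam = (S h \ox 1) * comul H Lam.
Proof.
pose L := tensl_ahom A A; pose R : 'Hom(A, tensor A A) := linfun (tensr (1 : A)).
have LR : conv H L R = comul H.
  apply/lfunP => x; rewrite convE.
  elim/tensor_ind: (comul H x) => [a b|s t Hs Ht]; last by rewrite !lfunD Hs Ht.
  by rewrite tmap_tens tmul_tens tensl_ahomE linfun_tensr tensM mulr1 mul1r.
have LSR : conv H (L \o S) (comul H) = R.
  rewrite -LR convA -{2}[ahval L]comp_lfun1r -comp_conv conv_antipodel.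
  by rewrite comp_convu convul.
rewrite -linfun_tensr -/R -LSR -tensl_ahomE -/L.
have comulLam : (amulr (comul H Lam) \o comul H)%VF
    = (amulr (comul H Lam) \o convu H _)%VF.
  apply/lfunP => x; rewrite !comp_lfunE !amulrE convuE -ahomM LamP.
  by rewrite linearZ -scalerAl mul1r.
have := congr1 (fun f : 'Hom(A, tensor A A) => f h)
  (conv_amulr H (L \o S)%VF (comul H) (comul H Lam)).
by rewrite comulLam conv1r /= !comp_lfunE !amulrE => <-.
Qed.

Lemma antipode_dual a :
  a = tlift (fun x y => (lam (a * x) : K) *: y) (tmap \1 S (comul H Lam)).
Proof.
(* [T x] is [lam(x Lam_1) Lam_2]. The two preceding lemmas make it a left inverse of [S], hence also
   a right inverse. *)
pose T := (tunitl A \o tmap lam \1 \o amulr (comul H Lam)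
           \o tensl_ahom A A)%VF.
have TE x : T x = tunitl A (tmap lam \1 ((x \ox 1) * comul H Lam)).
  by rewrite !comp_lfunE amulrE tensl_ahomE.
have TS : (T \o S)%VF = \1%VF.
  apply/lfunP => h; rewrite comp_lfunE TE -left_integral_comul id_lfunE.
  transitivity (h * tunitl A (tmap lam \1 (comul H Lam))); last first.
    by rewrite right_integral_comul mulr1.
  elim/tensor_ind: (comul H Lam) => [x y|s t Hs Ht].
    by rewrite tensM !tmap_tens !tunitl_tens !id_lfunE mul1r scalerAr.
  by rewrite mulrDr !lfunD mulrDr Hs Ht.
have {1}-> : a = S (T a) by rewrite -comp_lfunE (lfun_linvr TS) id_lfunE.
rewrite TE.
elim/tensor_ind: (comul H Lam) => [x y|s t Hs Ht]; last first.
  by rewrite mulrDr !lfunD Hs Ht tliftD.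
rewrite tensM !tmap_tens !tunitl_tens !id_lfunE tlift_tens ?mul1r ?lfunZ //.
  by move=> v k u w; rewrite mulrDr -scalerAr linearP scalerDl scalerA.
by move=> v k u w; rewrite scalerDr !scalerA mulrC.
Qed.

(** The dual bases give [lam(S(Lam_2) S(P(Lam_1)))], and [S] is anti-multiplicative. *)
Lemma trace_antipode (P : 'End(A)) :
  lfun_trace (S \o P)%VF = lam (S (conv H P \1 Lam)).
Proof.
rewrite (lfun_trace_dual (b := fun x y => lam (x * y)) _ _ antipode_dual); last first.
  by move=> u k x y; rewrite mulrDr -scalerAr linearP.
rewrite convE.
elim/tensor_ind: (comul H Lam) => [x y|s t Hs Ht]; last by rewrite !lfunD tliftD Hs Ht.
rewrite !tmap_tens tmul_tens tlift_tens ?antipodeM ?comp_lfunE ?id_lfunE //.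
  by move=> v k u w; rewrite linearP mulrDr -scalerAr linearP.
by move=> v k u w; rewrite mulrDl -scalerAl linearP.
Qed.

Lemma indicator_integral n : (0 < n)%N ->
  indicator H n = lam (S (sweedler H n Lam)).
Proof.
case: n => // n _; rewrite /indicator !sweedlerE trace_antipode.
by rewrite conv_powSr.
Qed.

End Integrals.

(** * Iterated comultiplications and twists *)

Section TensorPowers.
Variables (K : fieldType) (A : falgType K).

(** The spaces [tpow] with their algebra structure; there are again [n.+1] factors. *)
Fixpoint tpower n : falgType K :=
  if n is n'.+1 then tensor A (tpower n') else A.

Fixpoint tprod n : 'Hom(tpower n, A) :=
  if n is n'.+1 return 'Hom(tpower n, A) then (tmul A \o tmap \1 (tprod n'))%VF
  else \1%VF.

(** Since [tpower] is nested to the right, appending a last factor takes an iterated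
    reassociation. *)
Fixpoint tsnoc n : 'AHom(tensor (tpower n) A, tpower n.+1) :=
  if n is n'.+1 return 'AHom(tensor (tpower n) A, tpower n.+1) then
    (tmap_ahom (id_ahom A) (tsnoc n') \o tassoc_ahom A (tpower n') A)%AF
  else id_ahom _.

Lemma tsnocS n t a b :
  tsnoc n.+1 ((a \ox t) \ox b) = a \ox tsnoc n (t \ox b).
Proof. by rewrite comp_lfunE /= tassoc_tens tmap_tens id_lfunE. Qed.

(* [interleave (c_0 \ox ... \ox c_{n+1}) (t_0 \ox ... \ox t_n)] is
   [c_0 t_0 c_1 t_1 ... t_n c_{n+1}]. *)
Fixpoint interleave n : tpower n.+1 -> tpower n -> A :=
  if n is n'.+1 return tpower n.+1 -> tpower n -> A then
    fun c => tlift (fun t0 t =>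
      tlift (fun c0 c' => c0 * t0 * interleave c' t) c)
  else fun c t => tlift (fun c0 c1 => c0 * t * c1) c.

Fact interleave_is_linear n c : linear (@interleave n c).
Proof.
case: n c => [|n] c; last exact: tlift_is_linear.
move=> k s t; apply: tlift_comb => c0 c1.
by rewrite mulrDr mulrDl -scalerAr -scalerAl.
Qed.
HB.instance Definition _ n c := GRing.isLinear.Build K (tpower n) A _
  (@interleave n c) (@interleave_is_linear n c).

Lemma interleave_linearl n t : linear (fun c => @interleave n c t).
Proof.
case: n t => [|n] t; first exact: tlift_is_linear.
by move=> k c d; apply: tlift_comb => t0 t'; apply: tlift_is_linear.
Qed.

Lemma interleave0 c0 c1 (t : tpower 0) : @interleave 0 (c0 \ox c1) t = c0 * t * c1.
Proof.
rewrite /= tlift_tens // => [d k x y|d k x y].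
  by rewrite !mulrDl -!scalerAl.
by rewrite mulrDr -scalerAr.
Qed.

Lemma interleaveS n c0 (c : tpower n.+1) t0 (t : tpower n) :
  @interleave n.+1 (c0 \ox c) (t0 \ox t) = c0 * t0 * interleave c t.
Proof.
have E x s : tlift (fun c0 c' => c0 * x * @interleave n c' s) (c0 \ox c)
           = c0 * x * interleave c s.
  rewrite tlift_tens // => [d k y z|d k y z]; first by rewrite !mulrDl -!scalerAl.
  by rewrite interleave_linearl mulrDr -scalerAr.
rewrite [LHS]/= tlift_tens ?E // => [d k y z|d k y z]; rewrite !E.
  by rewrite mulrDr mulrDl -scalerAr -scalerAl.
by rewrite interleave_is_linear mulrDr -scalerAr.
Qed.

Lemma interleaveDl n (c d : tpower n.+1) t :
  interleave (c + d) t = interleave c t + interleave d t.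
Proof. by rewrite -[c]scale1r interleave_linearl !scale1r. Qed.

Lemma interleaveDr n (c : tpower n.+1) s t :
  interleave c (s + t) = interleave c s + interleave c t.
Proof. by rewrite -[s]scale1r interleave_is_linear !scale1r. Qed.

Lemma interleave1 n t : interleave 1 t = tprod n t.
Proof.
elim: n t => [|n IHn] t; first by rewrite interleave0 mul1r mulr1 id_lfunE.
elim/tensor_ind: t => [t0 t|s t Hs Ht]; last by rewrite interleaveDr lfunD Hs Ht.
by rewrite interleaveS IHn mul1r comp_lfunE tmap_tens tmul_tens id_lfunE.
Qed.

(** The left argument has factors [b z_0], [s_0 z_1], ..., [s_n a], so the interleaved product
    regroups into the blocks [z_i t_i s_i] between [b] and [a]. *)
Lemma interleave_tsnoc n (b : A) (s t z : tpower n) (a : A) :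
  interleave ((b \ox s) * tsnoc n (z \ox a)) t = b * tprod n (z * t * s) * a.
Proof.
elim: n b s t z => [|n IHn] b s t z.
  by rewrite !id_lfunE tensM interleave0 !mulrA.
elim/tensor_ind: z => [z0 z|x y Hx Hy]; last first.
  by rewrite tensDl lfunD mulrDr interleaveDl Hx Hy !mulrDl lfunD mulrDr mulrDl.
rewrite tsnocS tensM.
elim/tensor_ind: t => [t0 t|x y Hx Hy]; last first.
  by rewrite interleaveDr Hx Hy mulrDr !mulrDl lfunD mulrDr mulrDl.
elim/tensor_ind: s => [s0 s|x y Hx Hy]; last first.
  by rewrite mulrDl tensDr interleaveDl Hx Hy mulrDr lfunD mulrDr mulrDl.
rewrite interleaveS IHn !tensM comp_lfunE tmap_tens tmul_tens id_lfunE.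
by rewrite !mulrA.
Qed.

End TensorPowers.

Section IteratedComul.
Variables (K : fieldType) (A : falgType K) (B : bialgebra A).

Fixpoint tcomul n : 'AHom(A, tpower A n) :=
  if n is n'.+1 return 'AHom(A, tpower A n) then
    (tmap_ahom (id_ahom A) (tcomul n') \o comul B)%AF
  else id_ahom A.

Lemma tcomulS n h : tcomul n.+1 h = tmap \1 (tcomul n) (comul B h).
Proof. by rewrite comp_lfunE. Qed.

Lemma conv_powE n : conv_pow B n.+1 = (tprod A n \o tcomul n)%VF.
Proof.
elim: n => [|n IHn]; first by rewrite /= comp_lfun1l convur.
apply/lfunP => h.
rewrite -[conv_pow B n.+2]/(conv B \1 (conv_pow B n.+1)) IHn.
by rewrite convE comp_lfunE tcomulS comp_lfunE tmap_comp comp_lfun1l.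
Qed.

Lemma tsnoc_tmapS n x :
  tsnoc A n.+1 (tmap (tcomul n.+1) \1 x)
    = tmap \1 (tsnoc A n \o tmap (tcomul n) \1) (tassoc A A A (tmap (comul B) \1 x)).
Proof.
rewrite comp_lfunE /=.
have -> : tmap (tcomul n.+1) \1 x
    = tmap (tmap \1 (tcomul n)) \1 (tmap (comul B) \1 x).
  by rewrite tmap_comp comp_lfun1l.
by rewrite tassoc_tmap tmap_comp comp_lfun1l.
Qed.

(** Generalized coassociativity: [tcomul] splits the first factor off by definition, this splits off
    the last. *)
Lemma tsnoc_tcomul n h : tsnoc A n (tmap (tcomul n) \1 (comul B h)) = tcomul n.+1 h.
Proof.
elim: n h => [|n IHn] h; first by rewrite tcomulS id_lfunE.
rewrite tsnoc_tmapS comulA tmap_comp comp_lfun1l [RHS]tcomulS.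
congr (tmap _ _ _); apply/lfunP => x.
by rewrite -[RHS]IHn !comp_lfunE.
Qed.

End IteratedComul.

Section IteratedTwist.
Variables (K : fieldType) (A : falgType K) (B : bialgebra A) (F : tensor A A).
Local Notation delta := (tcomul B).

(** The iterated twist conjugating [tcomul], indexed so that [ttwist n] has [n.+1] factors and
    [ttwist 1] is [F]. *)
Fixpoint ttwist n : tpower A n :=
  if n is n'.+1 return tpower A n then
    (1 \ox ttwist n') * tmap \1 (delta n') F
  else 1.

Lemma ttwistS n : ttwist n.+1 = (1 \ox ttwist n) * tmap \1 (delta n) F.
Proof. by []. Qed.

(** The recursion of [ttwist] from the other end; the cocycle condition exchanges the two
    bracketings. *)
Lemma ttwist_tsnoc n : cocycle2 B F ->
  tsnoc A n ((ttwist n \ox 1) * tmap (delta n) \1 F) = ttwist n.+1.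
Proof.
move=> cF; elim: n => [|n IHn]; first by rewrite ttwistS id_lfunE.
rewrite ttwistS.
have -> : tmap (delta n.+1) \1 F = tmap (tmap \1 (delta n)) \1 (tmap (comul B) \1 F).
  by rewrite tmap_comp comp_lfun1l.
have -> : ((1 \ox ttwist n) * tmap \1 (delta n) F) \ox (1 : A)
  = ((1 \ox ttwist n) \ox 1) * tmap (tmap \1 (delta n)) \1 (F \ox 1).
  by rewrite tmap_tens id_lfunE tensM mulr1.
pose al := tassoc_ahom A A A.
pose ih := tmap_ahom (id_ahom A) (delta n).
pose jh := tmap_ahom ih (id_ahom A).
pose kh := tmap_ahom (id_ahom A) (tmap_ahom (delta n) (id_ahom A)).
pose sh := tmap_ahom (id_ahom A) (tsnoc A n).
rewrite -[tmap (tmap _ _) _ (F \ox 1)]/(jh _) -[tmap (tmap _ _) _ (tmap _ _ _)]/(jh _).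
rewrite -mulrA -ahomM [LHS]ahomM tsnocS.
have -> y : tsnoc A n.+1 (jh y) = sh (kh (al y)).
  by rewrite comp_lfunE /= tassoc_tmap.
rewrite -[al _]/(tassoc _ _ _ _) -cF !ahomM mulrA; congr (_ * _).
  (* The factor [1 \ox F] is absorbed by the induction hypothesis; the other one is generalized
     coassociativity. *)
  rewrite -[kh _]/(tmap _ _ (1 \ox F)) tmap_tens -[sh _]/(tmap _ _ (_ \ox _)).
  by rewrite tmap_tens !id_lfunE tensM mulr1 /= -ahomM IHn.
rewrite -[kh _]/(tmap _ _ (tmap _ _ F)) -[sh _]/(tmap _ _ (tmap _ _ (tmap _ _ F))).
rewrite !tmap_comp !comp_lfun1l; congr (tmap _ _ _); apply/lfunP => x.
by rewrite -[RHS]tsnoc_tcomul !comp_lfunE.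
Qed.

Hypotheses (gF : gauge_transformation B F) (cF : cocycle2 B F).

Lemma gauge_unit : F \is a GRing.unit. Proof. by case: gF. Qed.

Lemma ttwist_unit n : ttwist n \is a GRing.unit.
Proof.
elim: n => [|n IHn]; first exact: unitr1.
rewrite ttwistS unitrMl ?unit_tens ?unitr1 //.
exact: (rmorph_unit (tmap_ahom (id_ahom A) (delta n)) gauge_unit).
Qed.

(** Conjugation by [F] passes through the algebra map [ih] and merges with conjugation by
    [1 \ox ttwist n]. *)
Lemma tcomul_twist n h :
  tcomul (twist gF cF) n h = ttwist n * delta n h / ttwist n.
Proof.
elim: n h => [|n IHn] h; first by rewrite id_lfunE mul1r divr1.
have uF := gauge_unit; have uFn := ttwist_unit n.
pose ih := tmap_ahom (id_ahom A) (delta n).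
rewrite tcomulS twist_comulE.
transitivity (aconj (1 \ox ttwist n) (ih (aconj F (comul B h)))).
  rewrite -aconjE; elim/tensor_ind: (aconj _ _) => [x y|s t Hs Ht]; last first.
    by rewrite !lfunD Hs Ht.
  rewrite /ih /= !tmap_tens aconjE invr_tens ?unitr1 // invr1 !tensM id_lfunE.
  by rewrite mul1r mulr1 IHn.
rewrite aconj_ahom // -aconjM ?unit_tens ?rmorph_unit ?unitr1 //.
by rewrite aconjE -tcomulS.
Qed.

End IteratedTwist.

(** * The antipode of a twist *)

Section TwistedAntipode.
Variables (K : fieldType) (A : falgType K) (H : hopf A) (F : tensor A A).
Hypotheses (gF : gauge_transformation H F) (cF : cocycle2 H F).
Local Notation S := (antipode H).
Local Notation delta := (tcomul H).

(** [twist_l F] and [twist_r F^-1] are the elements [U] and [V]; arbitrary arguments allow reduction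
    to pure tensors. *)
Definition twist_l (x : tensor A A) : A := tmul A (tmap \1 S x).
Definition twist_r (x : tensor A A) : A := tmul A (tmap S \1 x).
Definition twist_antipode : 'End(A) :=
  (amulr (twist_r (F^-1)%R) \o (amull (twist_l F) \o S))%VF.

Lemma twist_lD x y : twist_l (x + y) = twist_l x + twist_l y.
Proof. by rewrite /twist_l !lfunD. Qed.
Lemma twist_rD x y : twist_r (x + y) = twist_r x + twist_r y.
Proof. by rewrite /twist_r !lfunD. Qed.
Lemma twist_l_tens a b : twist_l (a \ox b) = a * S b.
Proof. by rewrite /twist_l tmap_tens tmul_tens id_lfunE. Qed.
Lemma twist_r_tens a b : twist_r (a \ox b) = S a * b.
Proof. by rewrite /twist_r tmap_tens tmul_tens id_lfunE. Qed.

(** Anti-multiplicativity nests the product: [x_1 y_1 c S(x_2 y_2) = x_1 (y_1 c S(y_2)) S(x_2)]. *)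
Lemma tmap_amull_antipodeM c x y :
  tmul A (tmap \1 (amull c \o S) (x * y))
    = tmul A (tmap \1 (amull (tmul A (tmap \1 (amull c \o S) y)) \o S) x).
Proof.
elim/tensor_ind: x => [a b|s t Hs Ht]; last by rewrite mulrDl !lfunD Hs Ht.
elim/tensor_ind: y => [a' b'|s t Hs Ht]; last first.
  rewrite mulrDr !lfunD Hs Ht !tmap_tens !tmul_tens !comp_lfunE !amullE.
  by rewrite mulrDl mulrDr.
rewrite tensM !tmap_tens !tmul_tens !comp_lfunE !amullE antipodeM !id_lfunE.
by rewrite !mulrA.
Qed.

Lemma twist_lM1 x y : twist_l (x * y)
  = tmul A (tmap \1 (amull (twist_l y) \o S) x).
Proof.
have := tmap_amull_antipodeM 1 x y.
by rewrite amull1 comp_lfun1l.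
Qed.

(** On pure tensors this is [a S(c b) d = a S(b) S(c) d]. *)
Lemma twist_mul_tassoc (x y : tensor A A) :
  tmul A (tmap \1 (tmul A \o tmap S \1) ((1 \ox y) * tassoc A A A (x \ox 1)))
    = twist_l x * twist_r y.
Proof.
elim/tensor_ind: x => [a b|s t Hs Ht]; last first.
  by rewrite tensDl lfunD mulrDr !lfunD Hs Ht twist_lD mulrDl.
elim/tensor_ind: y => [c d|s t Hs Ht]; last first.
  by rewrite tensDr mulrDl !lfunD Hs Ht twist_rD mulrDr.
rewrite tassoc_tens !tensM !tmap_tens tmul_tens comp_lfunE tmap_tens tmul_tens.
by rewrite !id_lfunE antipodeM twist_l_tens twist_r_tens mul1r mulr1 !mulrA.
Qed.

(** On pure tensors this is [a c_1 S(b_1 c_2) b_2 d], where both antipode axioms apply. *)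
Lemma twist_mul_comul (x y : tensor A A) :
  tmul A (tmap \1 (tmul A \o tmap S \1)
    (tmap \1 (comul H) x * tassoc A A A (tmap (comul H) \1 y)))
  = tunitr A (tmap \1 (counit H) x) * tunitl A (tmap (counit H) \1 y).
Proof.
elim/tensor_ind: x => [a b|s t Hs Ht]; last by rewrite lfunD mulrDl !lfunD Hs Ht mulrDl.
elim/tensor_ind: y => [c d|s t Hs Ht]; last by rewrite !lfunD mulrDr !lfunD Hs Ht mulrDr.
rewrite !tmap_tens tunitr_tens tunitl_tens !id_lfunE.
transitivity (a * twist_l (comul H c) * twist_r (comul H b) * d); last first.
  rewrite /twist_l /twist_r antipodel antipoder -!scalerAr -!scalerAl !mulr1.
  by rewrite !scalerA mulrC.
elim/tensor_ind: (comul H b) => [x y|s t Hs Ht]; last first.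
  by rewrite tensDr mulrDl !lfunD Hs Ht twist_rD mulrDr mulrDl.
elim/tensor_ind: (comul H c) => [x' y'|s t Hs Ht]; last first.
  by rewrite tensDl lfunD mulrDr !lfunD Hs Ht twist_lD mulrDr !mulrDl.
rewrite tassoc_tens !tensM !tmap_tens tmul_tens comp_lfunE tmap_tens tmul_tens.
by rewrite !id_lfunE antipodeM twist_l_tens twist_r_tens !mulrA.
Qed.

(* Apply [a \ox b \ox c |-> a S(b) c] to the cocycle condition. *)
Lemma twist_lr : twist_l F * twist_r F^-1 = 1.
Proof.
have uF := gauge_unit gF.
pose dl := tmap_ahom (comul H) (id_ahom A).
pose dr := tmap_ahom (id_ahom A) (comul H).
pose al := tassoc_ahom A A A.
(* The cocycle condition, rearranged so that each side fits one of the two preceding lemmas. *)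
have E : (1 \ox F^-1) * al (F \ox 1) = dr F * al (dl F^-1).
  have cF' : (1 \ox F) * dr F = al (F \ox 1) * al (dl F).
    by rewrite -ahomM; exact: cF.
  have -> : al (F \ox 1) = (1 \ox F) * dr F * al (dl F^-1).
    by rewrite cF' -mulrA -!ahomM divrr // !ahom1 mulr1.
  rewrite !mulrA tensM mulr1 mulVr //.
  by rewrite -[1 \ox 1]/(1 : tensor A (tensor A A)) mul1r.
rewrite -twist_mul_tassoc -[tassoc _ _ _ _]/(al _) E twist_mul_comul.
case: gF => _ e1 ->; rewrite mul1r.
pose el := (tunitl_ahom A \o tmap_ahom (counit H) (id_ahom A))%AF.
have elE x : tunitl A (tmap (counit H) \1 x) = el x by rewrite comp_lfunE.
(* [F^-1] inherits the normalization of [F] because [el] is an algebra map. *)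
by rewrite elE; have := ahomM el F^-1 F; rewrite mulVr // ahom1 -(elE F) e1 mulr1 => <-.
Qed.

(** In [F Delta(h) F^-1], peeled from the right, [F^-1] cancels [U] as [twist_l (F^-1 * F) = 1],
    then [Delta(h)] gives [eps(h)], and [F] restores [U], with [U V = 1]. *)
Lemma twist_antipoder :
  conv (twist gF cF) \1 twist_antipode = convu (twist gF cF) A.
Proof.
have uF := gauge_unit gF.
apply/lfunP => h; rewrite convE convuE twist_comulE.
transitivity (tmul A (tmap \1 (amull (twist_l F) \o S)
    (F * comul H h / F)) * twist_r F^-1).
  elim/tensor_ind: (_ / F) => [x y|s t Hs Ht]; last by rewrite !lfunD Hs Ht mulrDl.
  by rewrite !tmap_tens !tmul_tens comp_lfunE amulrE mulrA.
rewrite tmap_amull_antipodeM -twist_lM1 mulVr // -[1]/(1 \ox 1) twist_l_tens.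
rewrite antipode1 mulr1 amull1 comp_lfun1l -/(twist_l _) twist_lM1.
rewrite [twist_l (comul H h)]antipoder.
have -> : (amull ((counit H h : K) *: 1) \o S)%VF = (counit H h : K) *: S.
  by apply/lfunP => x; rewrite comp_lfunE amullE scale_lfunE -scalerAl mul1r.
have -> : tmul A (tmap \1 ((counit H h : K) *: S) F) = (counit H h : K) *: twist_l F.
  elim/tensor_ind: F => [x y|s t Hs Ht]; last by rewrite !lfunD Hs Ht twist_lD scalerDr.
  by rewrite tmap_tens tmul_tens scale_lfunE -scalerAr id_lfunE twist_l_tens.
by rewrite -scalerAl twist_lr.
Qed.

(* On pure tensors the left-hand map is [(L \o R) \o M], with [L], [R] the left and
   right multiplications by the outer factors of [x] and [y], and the right-hand
   one is [M \o (L \o R)]. *)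
Lemma trace_interleave n (X Y : tpower A n) (x y : tensor A A) :
  lfun_trace (amulr (twist_r y) \o (amull (twist_l x) \o S) \o
     (tprod A n \o (amulr Y \o (amull X \o delta n))))%VF
  = lfun_trace (S \o (linfun (interleave
      ((tmap \1 (delta n) y * (1 \ox Y)) *
       tsnoc A n ((X \ox 1) * tmap (delta n) \1 x))) \o delta n))%VF.
Proof.
pose I c : 'Hom(_, A) := linfun (@interleave K A n c).
have ID c d : I (c + d) = I c + I d.
  by apply/lfunP => t; rewrite add_lfunE !lfunE /= interleaveDl.
rewrite -/(I _).
elim/tensor_ind: x => [f1 f2|s t Hs Ht]; last first.
  rewrite twist_lD !lfunD mulrDr !lfunD mulrDr ID linearD.
  by rewrite !(comp_lfunDl, comp_lfunDr) !lfun_traceD Hs Ht.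
elim/tensor_ind: y => [g1 g2|s t Hs Ht]; last first.
  rewrite twist_rD !lfunD !mulrDl ID linearD.
  by rewrite !(comp_lfunDl, comp_lfunDr) !lfun_traceD Hs Ht.
pose M : 'End(A) := (amull (S f2) \o (amulr (S g1) \o
  (S \o (tprod A n \o (amulr Y \o (amull X \o delta n))))))%VF.
transitivity (lfun_trace ((amull f1 \o amulr g2) \o M)%VF).
  congr lfun_trace; apply/lfunP => h; rewrite !comp_lfunE !amullE !amulrE.
  by rewrite twist_l_tens twist_r_tens !mulrA.
rewrite lfun_traceC; congr lfun_trace; apply/lfunP => h.
rewrite !comp_lfunE !amullE !amulrE lfunE /= !tmap_tens !tensM !id_lfunE mulr1.
rewrite mul1r interleave_tsnoc !antipodeM !mulrA; congr (_ * _ * _).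
by rewrite !ahomM !mulrA.
Qed.

End TwistedAntipode.

(** * Gauge invariance of the indicators *)

Section GaugeInvariance.
Variables (K : fieldType) (A : falgType K) (H : hopf A) (F : tensor A A).
Hypotheses (gF : gauge_transformation H F) (cF : cocycle2 H F).

Lemma trace_twist n :
  lfun_trace (twist_antipode H F \o conv_pow (twist gF cF) n)%VF
    = lfun_trace (antipode H \o conv_pow H n)%VF.
Proof.
case: n => [|n].
  (* Here the two maps already agree, since [U S(1) V = 1]. *)
  congr lfun_trace; apply/lfunP => h; rewrite !comp_lfunE !convuE !lfunZ amulrE amullE.
  by rewrite antipode1 mulr1 (twist_lr gF cF).
rewrite !conv_powE.
have -> : tcomul (twist gF cF) n = (amulr ((ttwist H F n)^-1)%R \o
    (amull (ttwist H F n) \o tcomul H n))%VF :> 'Hom(_, _).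
  by apply/lfunP => h; rewrite !comp_lfunE amulrE amullE tcomul_twist.
rewrite trace_interleave ttwist_tsnoc //.
have -> : tmap \1 (tcomul H n) (F^-1)%R * (1 \ox (ttwist H F n)^-1)
    = (ttwist H F n.+1)^-1.
  have uF := gauge_unit gF.
  pose ih := tmap_ahom (id_ahom A) (tcomul H n).
  rewrite ttwistS -[tmap _ _ F]/(ih F) -[tmap _ _ _]/(ih F^-1).
  have uFn := ttwist_unit gF n; rewrite invrM ?unit_tens ?rmorph_unit ?unitr1 //.
  by rewrite invr_tens ?unitr1 // invr1 rmorphV.
(* The twist enters only through [ttwist H F n.+1] and its inverse, which cancel; interleaving with
   [1] is plain multiplication. *)
rewrite mulVr; last exact: (ttwist_unit gF n.+1).
have -> : linfun (@interleave K A n 1) = tprod A n.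
  by apply/lfunP => t; rewrite lfunE /= interleave1.
by [].
Qed.

(** The isomorphism intertwines antipodes and Sweedler powers, so the two traces are those of
    conjugate maps. *)
Lemma indicator_gauge (A' : falgType K) (H' : hopf A') n :
  bialgebra_iso H' (twist gF cF) -> indicator H' n = indicator H n.
Proof.
case=> phi [phi_bij phi_comul phi_counit].
rewrite /indicator !sweedlerE -trace_twist; set m := n.-1.
have phi0 : lker phi == 0%VS by apply/lker0P; apply: bij_inj.
have phiV : (phi \o phi^-1)%VF = \1%VF.
  have [psi _ phiK] := phi_bij; apply/lfunP => a.
  by rewrite -[a]phiK comp_lfunE lker0_lfunK ?id_lfunE.
have comm : (phi \o (antipode H' \o conv_pow H' m)
    = (twist_antipode H F \o conv_pow (twist gF cF) m) \o phi)%VF.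
  have HS := antipode_comp phi_comul phi_counit (conv_antipodel H')
    (twist_antipoder gF cF).
  by rewrite comp_lfunA HS -!comp_lfunA (conv_pow_comp phi_comul phi_counit).
have -> : (antipode H' \o conv_pow H' m)%VF = (phi^-1 \o
    ((twist_antipode H F \o conv_pow (twist gF cF) m) \o phi))%VF.
  by rewrite -comm (comp_lfunA phi^-1%VF) lker0_compVf // comp_lfun1l.
by rewrite lfun_traceC -(comp_lfunA _ phi phi^-1%VF) phiV comp_lfun1r.
Qed.

End GaugeInvariance.

Theorem theorem2p2 (K : fieldType) (A : falgType K) (H : hopf A) :
  (forall (A' : falgType K) (H' : hopf A'), gauge_equivalent H H' ->
     forall n : nat, (0 < n)%N -> indicator H' n = indicator H n)
  /\ (forall (lam : 'Hom(A, K^o)) (Lam : A),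
        right_integral H lam -> left_integral H Lam -> lam Lam = 1 ->
        forall n : nat, (0 < n)%N ->
          indicator H n = lam (antipode H (sweedler H n Lam))).
Proof.
split=> [A' H' [F [gF [cF iso]]] n _|lam Lam lamP LamP lam1 n n_gt0].
  exact: indicator_gauge iso.
exact: indicator_integral.
Qed.
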